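(* Let $T \in \mathbf{B}(\mathcal H)$ and let $\mathcal M$ be a nonzero subspace of $\mathcal H$. If $T$ is subspace-hypercyclic for $\mathcal M$, then $\mathcal M$ is not finite-dimensional.
   Context: $\mathcal H$ is a separable Hilbert space over $\mathbb C$; $\mathbf{B}(\mathcal H)$ is the set of bounded linear operators on $\mathcal H$; ''subspace'' always means topologically closed linear subspace; $\mathbb N_0 = \mathbb N\cup\{0\}$. For $x\in\mathcal H$, $\operatorname{Orb}(T,x) := \{T^n x : n\in\mathbb N_0\}$. $T$ is subspace-hypercyclic for a nonzero subspace $\mathcal M$ if there exists $x\in\mathcal H$ such that $\operatorname{Orb}(T,x)\cap\mathcal M$ is dense in $\mathcal M$. *)

(* Defs.v *)
From HB Require Import structures.
From mathcomp Require Import all_boot all_order all_algebra.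
From mathcomp Require Import sesquilinear.
From mathcomp Require Import all_classical all_reals.
From mathcomp Require Import topology normedtype.
From mathcomp Require Import complex.

Set Implicit Arguments.
Unset Strict Implicit.
Unset Printing Implicit Defensive.

Import Order.TTheory GRing.Theory Num.Theory.
Import numFieldNormedType.Exports.

Local Open Scope classical_set_scope.
Local Open Scope ring_scope.

Definition separable_space (X : topologicalType) :=
  exists D : set X, countable D /\ dense D.

Section Hilbert.
Variables (R : realType) (H : completeNormedModType R[i]).
Implicit Types (T : {linear H -> H}) (M : set H) (x : H).

(* [R[i]] is the field of complex numbers over [R]; the norm of [H] takes its
   values in the nonnegative reals of [R[i]]. *)
Definition norm_from_dot (dot : {dot H for Num.conj}) :=
  forall x, `|x| = sqrtC (dot x x).

Definition bounded_operator T :=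
  exists C : R[i], forall x, `|T x| <= C * `|x|.

Definition closed_subspace M := GRing.submod_closed [in M] /\ closed M.

Definition finite_dimensional M :=
  exists (n : nat) (e : 'I_n -> H),
    M = [set x | exists c : 'I_n -> R[i], x = \sum_(i < n) c i *: e i].

Definition orbit T x : set H := [set iter n T x | n in [set: nat]].

Definition dense_in (A M : set H) := A `<=` M /\ M `<=` closure A.

Definition subspace_hypercyclic T M :=
  exists x, dense_in (orbit T x `&` M) M.

End Hilbert.

(* Main.v *)
(* Let p be a nonzero polynomial of least degree with p(T) x = 0; one exists
   because infinitely many points of the orbit lie in the finite-dimensional M.
   Suppose p has a root a != 0 and write p = h (X - a).  Then z := h(T) x is an
   eigenvector and h(T) (T^n x) = a^n z.  Fix T^k x in M: its multiples are
   limits of points of the orbit, so every multiple of z is a limit of points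
   a^n z, although all |a^n| lie on the same side of 1.  Hence p is a monomial,
   so the orbit is finite, and it cannot be dense in M. *)
Require Import Defs.
From HB Require Import structures.
From mathcomp Require Import all_boot all_order all_algebra.
From mathcomp Require Import sesquilinear.
From mathcomp Require Import all_classical all_reals.
From mathcomp Require Import topology normedtype.
From mathcomp Require Import complex.

Set Implicit Arguments.
Unset Strict Implicit.
Unset Printing Implicit Defensive.

Import Order.TTheory GRing.Theory Num.Theory.
Import numFieldNormedType.Exports.

Local Open Scope classical_set_scope.
Local Open Scope ring_scope.

Section PolynomialCalculus.
Variables (F : fieldType) (V : lmodType F) (T : {linear V -> V}).
Implicit Types (p q : {poly F}) (x y : V).

(** The vector $p(T)x$. *)
Definition poly_op p x : V := \sum_(i < size p) p`_i *: iter i T x.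

Lemma iter_linear n (a : F) x y :
  iter n T (a *: x + y) = a *: iter n T x + iter n T y.
Proof. by elim: n => //= n ->; rewrite linearP. Qed.

(** Coefficients past the size read as 0; this brings polynomials of different sizes to a common
    index range. *)
Lemma poly_op_widen n p x : (size p <= n)%N ->
  poly_op p x = \sum_(i < n) p`_i *: iter i T x.
Proof.
move=> pn; rewrite -(subnKC pn) big_split_ord /= [X in _ + X]big1 ?addr0// => i _.
by rewrite nth_default ?leq_addr// scale0r.
Qed.

Lemma poly_opPl a p q x :
  poly_op (a *: p + q) x = a *: poly_op p x + poly_op q x.
Proof.
pose n := maxn (size (a *: p + q)) (maxn (size p) (size q)).
rewrite !(@poly_op_widen n) ?leq_max ?leqnn ?orbT//.
rewrite scaler_sumr -big_split; apply: eq_bigr => i _ /=.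
by rewrite coefD coefZ scalerDl scalerA.
Qed.

Lemma poly_opPr a p x y :
  poly_op p (a *: x + y) = a *: poly_op p x + poly_op p y.
Proof.
rewrite /poly_op scaler_sumr -big_split; apply: eq_bigr => i _ /=.
by rewrite iter_linear scalerDr !scalerA mulrC.
Qed.

Lemma poly_op0l x : poly_op 0 x = 0.
Proof. by rewrite /poly_op size_poly0 big_ord0. Qed.

Lemma poly_opB p x y : poly_op p (x - y) = poly_op p x - poly_op p y.
Proof. by rewrite addrC -scaleN1r poly_opPr scaleN1r addrC. Qed.

Lemma poly_opZ p a x : poly_op p (a *: x) = a *: poly_op p x.
Proof.
have p0 : poly_op p 0 = 0 by rewrite -[in LHS](subrr x) poly_opB subrr.
by rewrite -[a *: x]addr0 poly_opPr p0 addr0.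
Qed.

Lemma poly_op_iter p n x : poly_op p (iter n T x) = iter n T (poly_op p x).
Proof.
elim: n => //= n <-; rewrite /poly_op linear_sum; apply: eq_bigr => i _.
by rewrite linearZ -iterS -iterSr.
Qed.

Lemma poly_opMX p x : poly_op (p * 'X) x = T (poly_op p x).
Proof.
rewrite (@poly_op_widen (size p).+1); last first.
  by rewrite (leq_trans (size_polyMleq _ _))// size_polyX addn2.
rewrite big_ord_recl coefMX eqxx scale0r add0r linear_sum.
by apply: eq_bigr => i _; rewrite coefMX /= linearZ.
Qed.

Lemma poly_opXn n x : poly_op 'X^n x = iter n T x.
Proof.
elim: n => [|n IH]; last by rewrite exprSr poly_opMX IH.
by rewrite expr0 /poly_op size_poly1 big_ord1 coefC eqxx scale1r.
Qed.

Lemma poly_op_sum (I : finType) (c : I -> F) (p : I -> {poly F}) x :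
  poly_op (\sum_i c i *: p i) x = \sum_i c i *: poly_op (p i) x.
Proof.
apply: (big_ind2 (fun q y => poly_op q x = y)) => [|q1 y1 q2 y2 <- <-|i _].
- exact: poly_op0l.
- by rewrite -[q1 in LHS]scale1r poly_opPl scale1r.
- by rewrite -[c i *: p i]addr0 poly_opPl poly_op0l addr0.
Qed.

Lemma poly_op_XsubC a p x :
  poly_op (p * ('X - a%:P)) x = T (poly_op p x) - a *: poly_op p x.
Proof.
rewrite mulrBr addrC -mulNr mulrC -[- p]scaleN1r -scalerAr mul_polyC.
by rewrite scalerA mulN1r poly_opPl poly_opMX scaleNr addrC.
Qed.

End PolynomialCalculus.

(** The coordinate matrix has $n+1$ rows and rank at most $n$, so its left kernel contains a nonzero
    row. *)
Lemma spanned_family_dependent (F : fieldType) (V : lmodType F) n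
    (e : 'I_n -> V) (v : 'I_n.+1 -> V) :
  (forall i, exists c : 'I_n -> F, v i = \sum_j c j *: e j) ->
  exists2 a : 'I_n.+1 -> F, exists i, a i != 0 & \sum_i a i *: v i = 0.
Proof.
move=> /choice[c vE]; pose A := \matrix_(i, j) c i j.
have : kermx A != 0.
  by rewrite -mxrank_eq0 mxrank_ker -lt0n subn_gt0 ltnS rank_leq_col.
case/rowV0Pn => r rA r0; exists (r 0).
  by case/rV0Pn: r0 => i ri; exists i.
under eq_bigr do rewrite vE scaler_sumr.
rewrite exchange_big big1// => j _.
under eq_bigr do rewrite scalerA.
rewrite -scaler_suml; move/sub_kermxP/matrixP/(_ 0 j): rA.
rewrite !mxE; under eq_bigr do rewrite mxE.
by move=> ->; rewrite scale0r.
Qed.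

(** Strong induction on the size of [p]: after splitting off a factor $X - a$ with $a \neq 0$, the
    cofactor either still kills [x] and is smaller, or sends [x] to an eigenvector. *)
Lemma eigenvector_of_annihilator (F : closedFieldType) (V : lmodType F)
    (T : {linear V -> V}) (p : {poly F}) x :
  p != 0 -> poly_op T p x = 0 -> (forall n, iter n T x != 0) ->
  exists a h, [/\ a != 0, poly_op T h x != 0 &
    T (poly_op T h x) = a *: poly_op T h x].
Proof.
move=> + + xN0; have [n] := ubnP (size p); elim: n p => // n IH p pn p0 px.
(* Removing the full power of $X$ leaves [q] with $q(0) \neq 0$, so every root of [q] is nonzero. *)
have [m [q + pE]] := multiplicity_XsubC p 0; rewrite p0 /= => q0.
(* A constant [q] would make $p(T)x$ a nonzero multiple of $T^m x$, which is not 0. *)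
have [q1|/closed_rootP[a qa]] := eqVneq (size q) 1%N.
  have /size_poly1P[c c0 qc] : size q == 1%N by rewrite q1.
  move: px; rewrite pE qc subr0 mul_polyC -[_ *: _]addr0 poly_opPl poly_op0l.
  rewrite addr0 poly_opXn => /eqP; rewrite scaler_eq0 (negbTE c0).
  by rewrite (negbTE (xN0 m)).
have /factor_theorem[h qE] := qa.
pose g := h * ('X - 0%:P) ^+ m.
have pgE : p = g * ('X - a%:P) by rewrite pE qE /g mulrAC.
have g0 : g != 0 by apply: contraNneq p0; rewrite pgE => ->; rewrite mul0r.
have [gx|gx] := eqVneq (poly_op T g x) 0.
  apply: IH gx => //; move: pn.
  by rewrite pgE size_Mmonic ?monicXsubC// size_XsubC addn2.
exists a, g; split=> //; first by apply: contraNneq q0 => <-.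
by apply/eqP; rewrite -subr_eq0 -poly_op_XsubC -pgE px.
Qed.

Section Density.
Variables (R : realType) (H : completeNormedModType R[i]).
Variables (T : {linear H -> H}) (M : set H) (x : H).
Hypothesis Tbounded : bounded_operator T.
Hypothesis Msub : closed_subspace M.
Hypothesis Mnonzero : M <> [set 0].
Hypothesis xM : dense_in (Defs.orbit T x `&` M) M.

Lemma subspaceZ a v : M v -> M (a *: v).
Proof.
move=> Mv; have [[M0 MP] _] := Msub.
by have := MP a v 0 (mem_set Mv) M0; rewrite addr0 => /set_mem.
Qed.

Lemma subspace_neq0 : exists2 v, M v & v != 0.
Proof.
apply: contrapT => nv; apply: Mnonzero; apply/seteqP; split=> v /=.
  by move=> Mv; apply: contrapT => /eqP v0; apply: nv; exists v.
by move=> ->; apply: set_mem; have [[]] := Msub.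
Qed.

Lemma orbit_approx v e : M v -> 0 < e ->
  exists2 n, M (iter n T x) & `|v - iter n T x| < e.
Proof.
move=> Mv e0; have [_ /(_ v Mv)] := xM.
move=> /(_ _ (nbhsx_ballx v e e0))[_ [[[n _ <-] Mn]]].
by rewrite -ball_normE; exists n.
Qed.

(** An orbit point within 1 of a vector of [M] of norm $C + 1$ cannot have norm at most $C$. The
    negated form avoids a comparability argument in the partial order of [R[i]]. *)
Lemma orbit_unbounded C : 0 <= C ->
  exists2 n, M (iter n T x) & ~ `|iter n T x| <= C.
Proof.
move=> C0; have [v Mv v0] := subspace_neq0.
have nv0 : `|v| != 0 by rewrite normr_eq0.
have C1 : 0 <= C + 1 by rewrite addr_ge0.
have [n Mn nlt] := orbit_approx (subspaceZ ((C + 1) / `|v|) Mv) ltr01.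
exists n => // nC; have := le_lt_trans (ler_normD _ _) (ltr_leD nlt nC).
rewrite subrK normrZ normrM normfV normr_id divfK// ger0_norm//.
by rewrite addrC ltxx.
Qed.

(** The sum of the norms of the first [k] orbit points bounds each of them, so a point exceeding it
    comes later. *)
Lemma orbit_hits_beyond k : exists2 n, (k <= n)%N & M (iter n T x).
Proof.
have [n Mn nk] : exists2 n, M (iter n T x) &
    ~ `|iter n T x| <= \sum_(i < k) `|iter i T x|.
  by apply: orbit_unbounded; rewrite sumr_ge0.
exists n => //; rewrite leqNgt; apply/negP => ltnk; apply: nk.
by rewrite (bigD1 (Ordinal ltnk))//= lerDl sumr_ge0.
Qed.

(** Once an iterate vanishes, so do all later ones, and the orbit is bounded. *)
Lemma orbit_neq0 n : iter n T x != 0.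
Proof.
apply/eqP => n0.
have [k Mk kn] : exists2 k, M (iter k T x) &
    ~ `|iter k T x| <= \sum_(i < n) `|iter i T x|.
  by apply: orbit_unbounded; rewrite sumr_ge0.
apply: kn.
have [ltkn|lenk] := ltnP k n.
  by rewrite (bigD1 (Ordinal ltkn))//= lerDl sumr_ge0.
rewrite -(subnK lenk) iterD n0.
suff -> : iter (k - n) T 0 = 0 by rewrite normr0 sumr_ge0.
by elim: (k - n)%N => //= j ->; rewrite linear0.
Qed.

Lemma orbit_annihilated : finite_dimensional M ->
  exists2 p : {poly R[i]}, p != 0 & poly_op T p x = 0.
Proof.
move=> [d [e ME]].
have /choice[f fP] k : exists n, (k < n)%N /\ M (iter n T x).
  by have [n kn Mn] := orbit_hits_beyond k.+1; exists n.
(* Strictly increasing exponents; starting at [f 0] rather than 0 puts the first orbit point in [M]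
   too. *)
pose s i := iter i f (f 0).
have sM i : M (iter (s i) T x).
  by case: i => [|i] /=; [have [] := fP 0 | have [] := fP (s i)].
have s_inj : injective s.
  apply/incn_inj/leq_mono/(homo_ltn ltn_trans) => i.
  by have [] := fP (s i).
have [a [i ai]] : exists2 a : 'I_d.+1 -> R[i], exists i, a i != 0 &
    \sum_i a i *: iter (s i) T x = 0.
  by apply: (@spanned_family_dependent _ _ d e) => i; have := sM i; rewrite {1}ME.
under eq_bigr do rewrite -poly_opXn.
rewrite -poly_op_sum => ax; exists (\sum_i a i *: 'X^(s i)) => //.
(* As [s] is injective, the coefficient at [s i] is exactly [a i]. *)
apply: contraNneq ai => /(congr1 (fun p : {poly _} => p`_(s i))).
rewrite coef0 coef_sum (bigD1 i)//= coefZ coefXn eqxx mulr1 big1 ?addr0// => [->//|j ji].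
rewrite coefZ coefXn; case: eqP => [/s_inj/val_inj ij|_]; last by rewrite mulr0.
by rewrite ij eqxx in ji.
Qed.

Lemma poly_op_bounded p :
  exists2 C : R[i], 0 < C & forall y, `|poly_op T p y| <= C * `|y|.
Proof.
have [C0 hC0] := Tbounded.
(* [C0] is an arbitrary complex number, but $C_0 |y|$ bounds a norm, so it is nonnegative and equals
   its own modulus. *)
have hC y : `|T y| <= `|C0| * `|y|.
  rewrite (le_trans (hC0 y))// -[`|y| in leRHS]normr_id -normrM ger0_norm//.
  exact: le_trans (hC0 y).
have iterC n y : `|iter n T y| <= `|C0| ^+ n * `|y|.
  elim: n => [|n IH]; first by rewrite mul1r.
  by rewrite (le_trans (hC _))// exprS -mulrA ler_wpM2l.
(* The summand 1 makes the constant positive, so that one may divide by it. *)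
exists (1 + \sum_(i < size p) `|p`_i| * `|C0| ^+ i).
  by rewrite ltr_pwDl// sumr_ge0// => i _; rewrite mulr_ge0// exprn_ge0.
move=> y; rewrite mulrDl mulr_suml mul1r ler_wpDl//.
rewrite (le_trans (ler_norm_sum _ _ _))// ler_sum// => i _.
by rewrite normrZ -mulrA ler_wpM2l.
Qed.

Lemma no_orbit_eigenvector p a : a != 0 -> poly_op T p x != 0 ->
  T (poly_op T p x) <> a *: poly_op T p x.
Proof.
set z := poly_op T p x => a0 z0 Tz.
have iterz n : iter n T z = a ^+ n *: z.
  by elim: n => [|n IH]; rewrite ?scale1r//= IH linearZ /= Tz scalerA exprSr.
have [k _ Mk] := orbit_hits_beyond 0.
have [C C0 hC] := poly_op_bounded p.
have nz : 0 < `|z| by rewrite normr_gt0.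
(* If $|a| \le 1$, aim at $2z$: all $a^n z$ have norm at most $|z|$. If $|a| > 1$, aim at 0: all
   have norm at least $|z|$. *)
have [c hc] : exists c, forall n, `|z| <= `|c *: (a ^+ k *: z) - a ^+ n *: z|.
  have [a1|a1] := real_leP (normr_real a) (ger0_real ler01).
    exists (2 / a ^+ k) => n; rewrite scalerA divfK ?expf_neq0// -scalerBl.
    rewrite normrZ ler_peMl// (le_trans _ (lerB_dist _ _))//.
    by rewrite lerBrDr normrX normr_nat (natrD _ 1 1) lerD2l exprn_ile1.
  exists 0 => n; rewrite scale0r sub0r normrN normrZ ler_peMl// normrX.
  by rewrite exprn_ege1// ltW.
(* $p(T)$ stretches distances by at most [C], so radius $|z|/C$ yields images closer than $|z|$,
   against [hc]. *)
have [n Mn] := orbit_approx (subspaceZ c Mk) (divr_gt0 nz C0).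
rewrite ltr_pdivlMr// mulrC => /(le_lt_trans (hC _)).
rewrite poly_opB poly_opZ !poly_op_iter -/z !iterz => /(le_lt_trans (hc n)).
by rewrite ltxx.
Qed.

End Density.

Theorem theorem4p10 (R : realType) (H : completeNormedModType R[i])
    (dot : {dot H for Num.conj}) (Hdot : norm_from_dot dot)
    (Hsep : separable_space H)
    (T : {linear H -> H}) (Tbounded : bounded_operator T)
    (M : set H) (Msub : closed_subspace M) (Mnonzero : M <> [set 0])
    (TM : subspace_hypercyclic T M) :
  ~ finite_dimensional M.
Proof.
move=> Mfin; have [x xM] := TM.
have [p p0 px] := orbit_annihilated Msub Mnonzero xM Mfin.
have [a [h [a0 hx]]] :=
  eigenvector_of_annihilator p0 px (orbit_neq0 Msub Mnonzero xM).
exact: no_orbit_eigenvector Tbounded Msub Mnonzero xM _ _ a0 hx.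
Qed.
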